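(* Let $\Phi : G \to H$ be a bi-resolving homomorphism of graphs with $H$ irreducible, and let $d = \deg \Phi$. \begin{enumerate} \item If $G$ is weakly connected, then there exists a bi-covering extension $\tilde \Phi : \tilde G \to H$ of $\Phi$ with $\tilde G$ irreducible and $\deg \tilde\Phi = d$. \item If $\lambda_H > \lambda_G$ and $n > d$ is an integer, then there exists a bi-covering extension $\tilde \Phi : \tilde G \to H$ of $\Phi$ with $\tilde G$ irreducible and $\deg \tilde\Phi = n$. \end{enumerate}
   Context: A graph $G$ is a finite directed graph: a pair $(\mathcal{V}(G),\mathcal{E}(G))$ of a finite set of vertices and a finite set of edges, each edge having an initial and a terminal vertex (loops and multiple edges are allowed). The adjacency matrix $A_G$ is indexed by $\mathcal{V}(G)\times\mathcal{V}(G)$ and its $(I,J)$ entry is the number of edges from $I$ to $J$; $\lambda_G$ denotes the spectral radius of $A_G$. $G$ is irreducible if for each pair $(I,J)$ of vertices there is a (directed) path from $I$ to $J$. $G$ is weakly connected if its underlying undirected graph is connected. A (graph) homomorphism $\Phi=(\Phi_{\mathcal V},\Phi_{\mathcal E}):G\to H$ is a pair of maps $\Phi_{\mathcal V}:\mathcal{V}(G)\to\mathcal{V}(H)$ and $\Phi_{\mathcal E}:\mathcal{E}(G)\to\mathcal{E}(H)$ respecting adjacency (an edge from $I$ to $J$ is sent to an edge from $\Phi_{\mathcal V}(I)$ to $\Phi_{\mathcal V}(J)$). $\Phi$ is right resolving (resp. right covering) if for each $I\in\mathcal{V}(G)$ the restriction of $\Phi_{\mathcal E}$ to the set of edges of $G$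 starting from $I$, viewed as a map into the set of edges of $H$ starting from $\Phi_{\mathcal V}(I)$, is injective (resp. bijective). Left resolving and left covering are defined in the same way with ''starting from'' replaced by ''ending at''. $\Phi$ is bi-resolving (resp. bi-covering) if it is both left and right resolving (resp. covering). The degree $\deg\Phi$ is the maximum over vertices $J\in\mathcal{V}(H)$ of the number of preimages $|\Phi_{\mathcal V}^{-1}(J)|$. An extension of $\Phi:G\to H$ is a homomorphism $\tilde\Phi:\tilde G\to H$ such that $\tilde G$ is a graph containing $G$ (as a subgraph) and $\tilde\Phi|_G=\Phi$. *)

(* Defs.v *)
From HB Require Import structures.
From mathcomp Require Import all_boot all_order all_algebra all_field.

Set Implicit Arguments.
Unset Strict Implicit.
Unset Printing Implicit Defensive.

Import Order.TTheory GRing.Theory Num.Theory.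

Local Open Scope ring_scope.

Record digraph := Digraph {
  vertex : finType;
  edge : finType;
  src : edge -> vertex;
  tgt : edge -> vertex }.

Section Graph.
Variable G : digraph.

Definition out_edges (I : vertex G) : {set edge G} := [set e | src e == I].
Definition in_edges (I : vertex G) : {set edge G} := [set e | tgt e == I].

Definition adjacent : rel (vertex G) :=
  [rel I J | [exists e : edge G, (src e == I) && (tgt e == J)]].

(* Paths may have length zero, so a single vertex without edges is irreducible. *)
Definition irreducible_graph : Prop :=
  forall I J : vertex G, connect adjacent I J.

Definition weakly_connected : Prop :=
  forall I J : vertex G,
    connect [rel x y | adjacent x y || adjacent y x] I J.

(* Row and column i stand for the i-th vertex in the enumeration of vertex G. *)
Definition adjacency_mx (R : pzSemiRingType) : 'M[R]_#|vertex G| :=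
  \matrix_(i, j) #|out_edges (enum_val i) :&: in_edges (enum_val j)|%:R.

End Graph.

(* The eigenvalues of A, with algebraic multiplicity. *)
Definition spectrum (n : nat) (A : 'M[algC]_n) : seq algC :=
  sval (closed_field_poly_normal (char_poly A)).

Lemma mem_spectrum (n : nat) (A : 'M[algC]_n) (z : algC) :
  (z \in spectrum A) = eigenvalue A z.
Proof.
rewrite eigenvalue_root_char /spectrum.
case: closed_field_poly_normal => r /= ->.
by rewrite (monicP (char_poly_monic A)) scale1r root_prod_XsubC.
Qed.

(* The moduli are nonnegative reals, on which the partial order of algC is the
   usual total one; the 0 x 0 matrix has spectral radius 0. *)
Definition spectral_radius (n : nat) (A : 'M[algC]_n) : algC :=
  \big[Num.max/0]_(z <- spectrum A) `|z|.

(* An adjacency matrix has integer entries, so its complex eigenvalues all lie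
   in algC. *)
Definition graph_spectral_radius (G : digraph) : algC :=
  spectral_radius (adjacency_mx G algC).

Record graph_hom (G H : digraph) := GraphHom {
  vmap : vertex G -> vertex H;
  emap : edge G -> edge H;
  src_emap : forall e, src (emap e) = vmap (src e);
  tgt_emap : forall e, tgt (emap e) = vmap (tgt e) }.

Section Hom.
Variables (G H : digraph) (Phi : graph_hom G H).

Definition right_resolving : Prop :=
  forall I : vertex G, {in out_edges I &, injective (emap Phi)}.

Definition left_resolving : Prop :=
  forall I : vertex G, {in in_edges I &, injective (emap Phi)}.

Definition right_covering : Prop :=
  forall I : vertex G,
    {in out_edges I &, injective (emap Phi)} /\
    emap Phi @: out_edges I = out_edges (vmap Phi I).

Definition left_covering : Prop :=
  forall I : vertex G,
    {in in_edges I &, injective (emap Phi)} /\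
    emap Phi @: in_edges I = in_edges (vmap Phi I).

Definition bi_resolving : Prop := left_resolving /\ right_resolving.

Definition bi_covering : Prop := left_covering /\ right_covering.

Definition degree : nat :=
  \max_(J : vertex H) #|[set I : vertex G | vmap Phi I == J]|.

End Hom.

(* G is regarded as a subgraph of G' through an injective homomorphism iota. *)
Definition is_extension (G G' H : digraph)
    (Phi : graph_hom G H) (Phi' : graph_hom G' H) : Prop :=
  exists iota : graph_hom G G',
    [/\ injective (vmap iota), injective (emap iota),
        (forall I, vmap Phi' (vmap iota I) = vmap Phi I) &
        (forall e, emap Phi' (emap iota e) = emap Phi e)].

(* Main.v *)
Require Import Defs.
From mathcomp Require Import all_boot all_order all_algebra all_field.
From mathcomp Require Import fingroup perm.

Set Implicit Arguments.
Unset Strict Implicit.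
Unset Printing Implicit Defensive.

Import Order.TTheory GRing.Theory Num.Theory.

Local Open Scope ring_scope.

(** A bi-covering of H whose fibers all have n points is the same thing as a
    choice, for each edge e of H, of a permutation [s e] of n sheets: the
    vertices over J are the pairs (J, t), and the lift of e starting on sheet t
    ends on sheet [s e t] ([derived]). Number the vertices in each fiber of
    Phi; since Phi is bi-resolving, the edges of G over e then prescribe a
    partial injection of the sheets, and completing these partial injections to
    permutations is exactly extending Phi to a bi-covering ([extends],
    [exists_extends]).

    Irreducibility rests on a counting argument. If a set D of vertices of the
    derived graph is closed under following edges, each [s e] injects the
    sheets of D over the source of e into those over its target. As H is
    irreducible, all these cardinals are equal, so the injections are
    bijections and D is also closed under following edges backwards
    ([forward_backward]). Hence reachability is symmetric, and a reachable set
    has the same number of sheets over every vertex of H.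

    If G is weakly connected and n = deg Phi, any completion is good: the
    vertices reachable from one vertex of G include all of G, which fills some
    fiber, hence they fill all fibers ([irreducible_of_full_fiber]).

    If n > deg Phi, one sheet, called star, can be left free of vertices of G
    and made into a copy of H. Among the completions for which this sheet stays
    in one component C, take one with C as large as possible. If C is not
    everything, some edge e has a lift that starts outside C on a sheet u and
    is not an edge of G; otherwise the vertices outside C would form a part of
    G, with no edge to or from the rest of G, that covers H, and the left
    eigenvectors of the adjacency matrix of H would pull back to G with the
    same nonzero eigenvalues ([eigenvalue_lift]), contradicting the assumption
    on spectral radii ([exists_missing_edge]). Exchanging the endpoints of the
    lifts of e on the sheets star and u keeps G intact and enlarges C
    ([reach_swap]), contradicting maximality. *)

(** * Spectral radius *)

Lemma bigmax_norm_ge0 (r : seq algC) : 0 <= \big[Num.max/0]_(z <- r) `|z|.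
Proof.
by elim/big_rec: _ => // z x _ x_ge0; rewrite /Num.max; case: ifP.
Qed.

Lemma spectral_radius_ge0 n (A : 'M[algC]_n) : 0 <= spectral_radius A.
Proof. exact: bigmax_norm_ge0. Qed.

Lemma normr_le_spectral_radius n (A : 'M[algC]_n) z :
  eigenvalue A z -> `|z| <= spectral_radius A.
Proof.
rewrite -mem_spectrum /spectral_radius; elim: (spectrum A) => // y s IHs.
rewrite in_cons big_cons.
(* The order of algC is partial, but moduli are comparable. *)
have cmp : `|y| >=< \big[Num.max/0]_(x <- s) `|x|.
  by rewrite real_comparable ?ger0_real ?bigmax_norm_ge0.
rewrite comparable_le_max //; case/orP => [/eqP-> | /IHs ->].
  by rewrite lexx.
by rewrite orbT.
Qed.

Lemma spectral_radius_le m n (A : 'M[algC]_m) (B : 'M[algC]_n) :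
  (forall z, z != 0 -> eigenvalue A z -> eigenvalue B z) ->
  spectral_radius A <= spectral_radius B.
Proof.
move=> AB; rewrite {1}/spectral_radius big_seq.
elim/big_rec: _ => [|z r zA le_rB]; first exact: spectral_radius_ge0.
rewrite /Num.max; case: ifP => // _.
have [->|z_neq0] := eqVneq z 0; first by rewrite normr0 spectral_radius_ge0.
by apply: normr_le_spectral_radius; apply: AB => //; rewrite -mem_spectrum.
Qed.

(** * Lifting eigenvectors along coverings *)

Lemma mulmx_adjacency (G : digraph) (R : pzSemiRingType)
    (v : 'rV[R]_#|vertex G|) j :
  (v *m adjacency_mx G R) 0 j =
  \sum_(g : edge G | tgt g == enum_val j) v 0 (enum_rank (src g)).
Proof.
rewrite mxE (partition_big (fun g => enum_rank (src g)) predT) //=.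
apply: eq_bigr => i _; rewrite mxE.
rewrite (eq_bigr (fun=> v 0 i)) => [|g /andP[_ /eqP->] //].
rewrite sumr_const mulr_natr; congr (_ *+ _); apply: eq_card => g.
by rewrite !inE unfold_in /= andbC -(inj_eq enum_val_inj) enum_rankK.
Qed.

(** A left eigenvector w of H lifts to the row vector with value [w (Phi x)] at
    the vertices x of K and 0 elsewhere. At a vertex of K the edges ending there
    correspond to those of H, so the eigenvector equation is the one for w; at
    other vertices both sides vanish because no edge leaves K. The lift is
    nonzero because w is, for z nonzero, determined by its values at sources of
    edges. *)
Lemma eigenvalue_lift (G H : digraph) (Phi : graph_hom G H)
    (K : {set vertex G}) (z : algC) :
    (forall g : edge G, (src g \in K) = (tgt g \in K)) ->
    (forall y, y \in K -> {in in_edges y &, injective (emap Phi)} /\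
                          emap Phi @: in_edges y = in_edges (vmap Phi y)) ->
    (forall e : edge H, exists2 x, x \in K & vmap Phi x = src e) ->
  z != 0 -> eigenvalue (adjacency_mx H algC) z ->
  eigenvalue (adjacency_mx G algC) z.
Proof.
move=> K_closed K_cov K_onto z_neq0 /eigenvalueP[w wA w_neq0].
pose v : 'rV[algC]_#|vertex G| := \row_i
  if enum_val i \in K then w 0 (enum_rank (vmap Phi (enum_val i))) else 0.
have vE x : v 0 (enum_rank x) =
    if x \in K then w 0 (enum_rank (vmap Phi x)) else 0.
  by rewrite mxE enum_rankK.
apply/eigenvalueP; exists v.
  apply/rowP=> j; rewrite mulmx_adjacency [RHS]mxE -[j in RHS]enum_valK vE.
  set y := enum_val j; case: ifPn => yK; last first.
    rewrite mulr0 big1 // => g /eqP gy.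
    by rewrite vE K_closed gy (negPf yK).
  have [inj_y im_y] := K_cov y yK.
  have := congr1 (fun u : 'rV_ _ => u 0 (enum_rank (vmap Phi y))) wA.
  rewrite /= mulmx_adjacency enum_rankK [RHS]mxE => <-.
  rewrite (eq_bigl (mem (in_edges y))) => [|g]; last by rewrite !inE.
  rewrite [RHS](eq_bigl (mem (in_edges (vmap Phi y)))) => [|g]; last first.
    by rewrite !inE.
  rewrite -im_y big_imset //=; apply: eq_bigr => g; rewrite inE => /eqP gy.
  by rewrite vE K_closed gy yK src_emap.
apply: contra_neq w_neq0 => v0.
have w_src e : w 0 (enum_rank (src e)) = 0.
  have [x xK <-] := K_onto e.
  by have := vE x; rewrite xK v0 mxE.
apply/rowP=> j; rewrite mxE; apply: (mulfI z_neq0).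
have := congr1 (fun u : 'rV_ _ => u 0 j) wA.
rewrite /= mulmx_adjacency [RHS]mxE => <-.
by rewrite mulr0 big1 // => e _; rewrite w_src.
Qed.

(** * Extending partial injections *)

(** Each new pair (x, y) is met by composing with the transposition of y and the
    current image of x, which moves no value prescribed before. *)
Lemma partial_injection_perm (T : finType) (s : seq (T * T)) :
  uniq (unzip1 s) -> uniq (unzip2 s) ->
  exists p : {perm T}, forall xy, xy \in s -> p xy.1 = xy.2.
Proof.
elim: s => [|[x y] s IHs] /=; first by exists 1%g.
case/andP=> x_notin uniq1 /andP[y_notin uniq2].
have [p ps] := IHs uniq1 uniq2.
exists (p * tperm (p x) y)%g => -[a b]; rewrite in_cons permM /=.
case/predU1P=> [[-> ->]|ab_s]; first by rewrite tpermL.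
have /= pab := ps _ ab_s; rewrite pab tpermD //.
  rewrite -pab; apply: contraNneq x_notin => /perm_inj ->.
  exact: (map_f fst ab_s).
by apply: contraNneq y_notin => ->; exact: (map_f snd ab_s).
Qed.

(** * Derived graphs of permutation voltages *)

Section Derived.
Variables (H : digraph) (T : finType).
Implicit Types (s : {ffun edge H -> {perm T}}) (D : {set vertex H * T}).

(** The permutation voltage graph of s, the general form of a covering of H with
    constant fiber size. *)
Definition derived s : digraph :=
  @Digraph (vertex H * T)%type (edge H * T)%type
    (fun et => (src et.1, et.2)) (fun et => (tgt et.1, s et.1 et.2)).

Definition derived_proj s : graph_hom (derived s) H :=
  @GraphHom (derived s) H fst fst (fun=> erefl) (fun=> erefl).

Lemma derived_bi_covering s : bi_covering (derived_proj s).
Proof.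
split=> -[I i]; split.
- move=> [e t] [f u]; rewrite !inE => /eqP[_ <-] /eqP[_ + /= ef].
  by rewrite -ef => /perm_inj->.
- apply/setP=> e; rewrite inE; apply/imsetP/eqP => [[[f t]]|eI].
    by rewrite inE => /eqP[<- _] ->.
  by exists (e, (s e)^-1%g i); rewrite // inE /= eI permKV.
- by move=> [e t] [f u]; rewrite !inE => /eqP[_ ->] /eqP[_ ->] /= ->.
- apply/setP=> e; rewrite inE; apply/imsetP/eqP => [[[f t]]|eI].
    by rewrite inE => /eqP[<- _] ->.
  by exists (e, i); rewrite // inE /= eI.
Qed.

Lemma degree_derived s (J0 : vertex H) : degree (derived_proj s) = #|T|.
Proof.
have fiber J : #|[set x : vertex (derived s) | vmap (derived_proj s) x == J]|
               = #|T|.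
  rewrite -(card_imset predT (f := pair J)) => [|t u [] //].
  apply: eq_card => -[I t]; rewrite inE /=.
  by apply/eqP/imsetP => [->|[u _ [-> _]]] //; exists t.
rewrite /degree (eq_bigr (fun=> #|T|)) => [|J _]; last exact: fiber.
apply/eqP; rewrite eqn_leq; apply/andP; split; first by apply/bigmax_leqP.
by rewrite (bigD1 J0) //= leq_maxl.
Qed.

Definition forward s D :=
  forall e t, (src e, t) \in D -> (tgt e, s e t) \in D.
Definition backward s D :=
  forall e t, (tgt e, s e t) \in D -> (src e, t) \in D.

Definition sheets D (J : vertex H) : {set T} := [set t | (J, t) \in D].

Hypothesis H_irr : irreducible_graph H.

(** Along every edge e, the permutation [s e] injects the sheets of D over the
    source into those over the target, and in H any vertex leads to any other. *)
Lemma forward_card_sheets s D I J :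
  forward s D -> #|sheets D I| = #|sheets D J|.
Proof.
move=> fwd; suff le I' J' : (#|sheets D I'| <= #|sheets D J'|)%N.
  by apply/eqP; rewrite eqn_leq !le.
have /connectP[p + ->] := H_irr I' J'.
elim: p I' => //= K p IHp I' /andP[/existsP[e /andP[/eqP <- /eqP eK]] /IHp].
apply: leq_trans; rewrite -(card_imset _ (@perm_inj _ (s e))) -eK.
apply/subset_leq_card/subsetP => _ /imsetP[t + ->].
by rewrite !inE => /fwd.
Qed.

(** The injection of sheets given by [s e] is between sets of the same size, so
    it is onto. *)
Lemma forward_backward s D : forward s D -> backward s D.
Proof.
move=> fwd e t tD.
have sub : s e @: sheets D (src e) \subset sheets D (tgt e).
  by apply/subsetP => _ /imsetP[u + ->]; rewrite !inE => /fwd.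
have /eqP im : s e @: sheets D (src e) == sheets D (tgt e).
  rewrite eqEcard sub (card_imset _ (@perm_inj _ _)).
  by rewrite (forward_card_sheets (src e) (tgt e) fwd) leqnn.
have : s e t \in sheets D (tgt e) by rewrite inE.
by rewrite -im => /imsetP[u + /perm_inj ->]; rewrite inE.
Qed.

Lemma backward_forward s D : backward s D -> forward s D.
Proof.
move=> bwd e t; have/forward_backward bwdC : forward s (~: D).
  by move=> f u; rewrite !inE; apply: contra => /bwd.
by apply: contraTT; rewrite -!in_setC => /bwdC.
Qed.

Lemma forward_closed s D :
  forward s D -> closed (@adjacent (derived s)) D.
Proof.
move=> fwd x y /existsP[[e t] /andP[/eqP<- /eqP<-]] /=.
by apply/idP/idP => [/fwd|/(forward_backward fwd)].
Qed.

Definition reach s (x : vertex H * T) : {set vertex H * T} :=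
  [set y | connect (@adjacent (derived s)) x y].

Lemma mem_reach s x : x \in reach s x.
Proof. by rewrite inE connect0. Qed.

Lemma reach_forward s x : forward s (reach s x).
Proof.
move=> e t; rewrite !inE => /connect_trans; apply; apply: connect1.
by apply/existsP; exists (e, t); rewrite /= !eqxx.
Qed.

Lemma reach_edge s x e t :
  ((tgt e, s e t) \in reach s x) = ((src e, t) \in reach s x).
Proof.
by apply/idP/idP => [/(forward_backward (@reach_forward s x))|/reach_forward].
Qed.

Lemma reach_min s x D : forward s D -> x \in D -> reach s x \subset D.
Proof.
move=> /forward_closed cl xD; apply/subsetP => y.
by rewrite inE => /(closed_connect cl) <-.
Qed.

(** Every vertex y can return to x because the set reachable from y is closed
    backwards and x reaches y. *)
Lemma derived_irreducible s x :
  reach s x = setT -> irreducible_graph (derived s).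
Proof.
move=> xT y z.
have from_x u : connect (@adjacent (derived s)) x u.
  by have := in_setT u; rewrite -xT inE.
have cl := forward_closed (@reach_forward s y).
have : y \in reach s y by exact: mem_reach.
by rewrite -(closed_connect cl (from_x y)) inE => /connect_trans; apply.
Qed.

Definition swap s e t u : {ffun edge H -> {perm T}} :=
  [ffun f => if f == e then (tperm t u * s f)%g else s f].

(** Exchanging one edge of a component with one outside keeps the component
    connected: the set D of its vertices that are still reachable from x is
    closed under all its edges in both directions, except possibly under the
    lift of e on sheet t. A single exceptional edge either does not leave D or
    does not enter it, so D is closed forward or backward, hence both, and D is
    the whole component. The new edge from sheet t then leads outside. *)
Lemma reach_swap s x e t u :
    (src e, t) \in reach s x -> (src e, u) \notin reach s x ->
  reach s x \proper reach (swap s e t u) x.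
Proof.
set s' := swap s e t u => etC euC.
have s'E f k : (src f, k) \in reach s x -> (f, k) != (e, t) ->
    s' f k = s f k.
  rewrite ffunE; have [->|//] := eqVneq f e => kC.
  rewrite xpair_eqE eqxx /= => k_neq; rewrite permM tpermD 1?eq_sym //.
  by apply: contraNneq euC => <-.
set D := reach s x :&: reach s' x.
have xD : x \in D by rewrite inE !mem_reach.
have DE f k : (f, k) != (e, t) ->
    ((tgt f, s f k) \in D) = ((src f, k) \in D).
  move=> fk; rewrite !in_setI reach_edge.
  case fkC: ((src f, k) \in reach s x) => //=.
  by rewrite -(s'E f k) // reach_edge.
have fwdD : forward s D.
  (* If the exceptional edge ends in D it cannot break forward closure;
     otherwise it cannot break backward closure. *)
  have [etD|etD] := boolP ((tgt e, s e t) \in D).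
    move=> f k; have [[-> ->] //|fk] := eqVneq (f, k) (e, t).
    by rewrite DE.
  apply: backward_forward => f k.
  have [[-> ->]|fk] := eqVneq (f, k) (e, t); first by rewrite (negPf etD).
  by rewrite DE.
have sub : reach s x \subset reach s' x.
  exact: subset_trans (reach_min fwdD xD) (subsetIr _ _).
rewrite properE sub; apply/subsetPn; exists (tgt e, s e u).
  have := subsetP sub _ etC; rewrite -reach_edge.
  by rewrite ffunE eqxx permM tpermL.
by rewrite reach_edge.
Qed.

End Derived.

(** * Completing a bi-resolving homomorphism to a bi-covering *)

Section Embedding.
Variables (G H : digraph) (Phi : graph_hom G H) (T : finType).
Variable lab : vertex G -> T.
Implicit Type s : {ffun edge H -> {perm T}}.
Hypothesis Phi_res : bi_resolving Phi.
Hypothesis lab_inj :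
  forall v w, vmap Phi v = vmap Phi w -> lab v = lab w -> v = w.

Definition extends s :=
  [forall g : edge G, s (emap Phi g) (lab (src g)) == lab (tgt g)].

Lemma edge_eq_src g g' :
  emap Phi g = emap Phi g' -> lab (src g) = lab (src g') -> g = g'.
Proof.
move=> eg lg; have sg : src g = src g'.
  by apply: lab_inj; rewrite // -!src_emap eg.
by case: Phi_res => _ /(_ (src g)); apply; rewrite ?inE ?sg.
Qed.

Lemma edge_eq_tgt g g' :
  emap Phi g = emap Phi g' -> lab (tgt g) = lab (tgt g') -> g = g'.
Proof.
move=> eg lg; have sg : tgt g = tgt g'.
  by apply: lab_inj; rewrite // -!tgt_emap eg.
by case: Phi_res => /(_ (tgt g)) + _; apply; rewrite ?inE ?sg.
Qed.

Lemma extends_is_extension s :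
  extends s -> is_extension Phi (derived_proj s).
Proof.
move=> /forallP ext.
pose iv v : vertex (derived s) := (vmap Phi v, lab v).
pose ie g : edge (derived s) := (emap Phi g, lab (src g)).
have srcE g : src (ie g) = iv (src g) by rewrite /= src_emap.
have tgtE g : tgt (ie g) = iv (tgt g).
  by rewrite /= tgt_emap (eqP (ext g)).
exists (GraphHom srcE tgtE); split=> //=.
- by move=> v w [/lab_inj vw /vw].
- by move=> g g' [/edge_eq_src gg' /gg'].
Qed.

Definition constraints (e : edge H) : seq (T * T) :=
  [seq (lab (src g), lab (tgt g)) | g <- enum (edge G) & emap Phi g == e].

Lemma extends_constraints s :
  (forall e xy, xy \in constraints e -> s e xy.1 = xy.2) -> extends s.
Proof.
move=> sP; apply/forallP => g; apply/eqP.
apply: (sP _ (lab (src g), lab (tgt g))); apply/mapP; exists g => //.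
by rewrite mem_filter eqxx mem_enum.
Qed.

Lemma uniq_constraints e :
  uniq (unzip1 (constraints e)) /\ uniq (unzip2 (constraints e)).
Proof.
have uE : uniq [seq g <- enum (edge G) | emap Phi g == e].
  by rewrite filter_uniq // enum_uniq.
split; rewrite /unzip1 /unzip2 -map_comp map_inj_in_uniq // => g g';
  rewrite !mem_filter => /andP[/eqP ge _] /andP[/eqP ge' _] /=.
- by apply: edge_eq_src; rewrite ge ge'.
- by apply: edge_eq_tgt; rewrite ge ge'.
Qed.

Lemma exists_extends : exists s, extends s.
Proof.
have sP e : exists p : {perm T},
    [forall xy, (xy \in constraints e) ==> (p xy.1 == xy.2)].
  have [u1 u2] := uniq_constraints e.
  have [p pP] := partial_injection_perm u1 u2.
  by exists p; apply/forallP => xy; apply/implyP => /pP ->.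
exists [ffun e => xchoose (sP e)]; apply: extends_constraints => e xy xy_e.
by rewrite ffunE; have /forallP/(_ xy)/implyP/(_ xy_e)/eqP := xchooseP (sP e).
Qed.

(** Composing with the transposition of star and its image restores star; no
    value prescribed by G is moved, since no vertex of G lies on the sheet star. *)
Lemma exists_extends_fixing star :
    (forall v, lab v != star) ->
  exists2 s, extends s & forall e, s e star = star.
Proof.
move=> starP; have [s /forallP ext] := exists_extends.
exists [ffun e => (s e * tperm (s e star) star)%g] => [|e]; last first.
  by rewrite ffunE permM tpermL.
apply/forallP => g; rewrite ffunE permM (eqP (ext g)) tpermD //.
  rewrite -(eqP (ext g)) (inj_eq perm_inj) eq_sym; exact: starP.
by rewrite eq_sym starP.
Qed.

Hypothesis H_irr : irreducible_graph H.

(** The component containing G has all sheets over J, hence over every vertex. *)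
Lemma irreducible_of_full_fiber s J :
    weakly_connected G -> extends s ->
    lab @: [set v | vmap Phi v == J] = setT ->
  irreducible_graph (derived s).
Proof.
move=> G_conn /forallP ext labT x y.
have: x.2 \in lab @: [set v | vmap Phi v == J] by rewrite labT inE.
(* As the fiber over J is full, the existence of a sheet gives a vertex of G. *)
case/imsetP=> v0 _ _.
apply: (@derived_irreducible _ _ H_irr _ (vmap Phi v0, lab v0)).
set C := reach s _.
have C_G v : (vmap Phi v, lab v) \in C.
  pose a := [pred w | (vmap Phi w, lab w) \in C].
  suff cl : closed [rel u w | adjacent u w || adjacent w u] a.
    have : v0 \in a by exact: mem_reach.
    by rewrite (closed_connect cl (G_conn v0 v)).
  have adjC u w : adjacent u w -> (u \in a) = (w \in a).
    case/existsP=> g /andP[/eqP<- /eqP<-].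
    rewrite -[LHS]/((vmap Phi (src g), lab (src g)) \in C).
    rewrite -[RHS]/((vmap Phi (tgt g), lab (tgt g)) \in C).
    by rewrite -src_emap -tgt_emap -(eqP (ext g)) reach_edge.
  by move=> u w /orP[/adjC | /adjC ->].
apply/setP=> -[I t]; rewrite [RHS]inE.
have sheetJ : sheets C J = setT.
  apply/eqP; rewrite eqEsubset subsetT -labT; apply/subsetP => _ /imsetP[v + ->].
  by rewrite inE => /eqP <-; rewrite [_ \in sheets _ _]inE C_G.
have : sheets C I == setT.
  rewrite eqEcard subsetT -sheetJ.
  by rewrite (forward_card_sheets H_irr I J (@reach_forward _ _ s _)) leqnn.
by move/eqP/setP/(_ t); rewrite inE [RHS]inE.
Qed.

(** If all lifts of edges starting in D were edges of G, then the vertices of G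
    in D would form a union of components covering H, and every nonzero
    eigenvalue of H would be one of G. *)
Lemma exists_missing_edge s D :
    graph_spectral_radius G < graph_spectral_radius H ->
    extends s -> forward s D -> D != set0 ->
  exists e t, (src e, t) \in D /\
    forall g, emap Phi g = e -> lab (src g) != t.
Proof.
move=> lt_rad /forallP ext fwd D_neq0.
have bwd := forward_backward H_irr fwd.
pose bad (et : edge H * T) := ((src et.1, et.2) \in D) &&
  [forall g, (emap Phi g == et.1) ==> (lab (src g) != et.2)].
have [/existsP[[e t] /andP[etD /forallP eg]]|/existsPn nobad] :=
  boolP [exists et, bad et].
  by exists e, t; split=> // g /eqP ge; have /implyP/(_ ge) := eg g.
have G_edge e t : (src e, t) \in D ->
    exists2 g, emap Phi g = e & lab (src g) = t.
  move=> etD; have := nobad (e, t).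
  rewrite /bad etD /= => /forallPn[g]; rewrite negb_imply negbK.
  by case/andP=> /eqP ge /eqP gt; exists g.
suff : graph_spectral_radius H <= graph_spectral_radius G.
  by move=> le; have := le_lt_trans le lt_rad; rewrite ltxx.
apply: spectral_radius_le => z z_neq0.
have /set0Pn[[I i] IiD] := D_neq0.
apply: (@eigenvalue_lift _ _ Phi [set v | (vmap Phi v, lab v) \in D]) => //.
- move=> g; rewrite !inE -src_emap -tgt_emap -(eqP (ext g)).
  by apply/idP/idP => [/fwd|/bwd].
- move=> y; rewrite inE => yD; split; first by case: Phi_res => + _; apply.
  apply/setP=> e; apply/imsetP/idP => [[g]|].
    by rewrite !inE => /eqP gy ->; rewrite tgt_emap gy.
  rewrite inE => /eqP ey.
  have /G_edge[g ge gt] : (src e, (s e)^-1%g (lab y)) \in D.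
    by apply: bwd; rewrite permKV ey.
  exists g; rewrite // inE; apply/eqP; apply: lab_inj.
    by rewrite -tgt_emap ge.
  by rewrite -(eqP (ext g)) ge gt permKV.
move=> e; have : sheets D (src e) != set0.
  rewrite -card_gt0 (forward_card_sheets H_irr _ I fwd) card_gt0.
  by apply/set0Pn; exists i; rewrite inE.
case/set0Pn=> t; rewrite inE => etD; have [g ge gt] := G_edge _ _ etD.
by exists (src g); rewrite ?inE -?src_emap ge ?gt.
Qed.

(** The completion is chosen to maximize the component of the sheet star; a
    proper component could be enlarged by a swap of two edges not in G. *)
Lemma exists_irreducible_extends star (J0 : vertex H) :
    graph_spectral_radius G < graph_spectral_radius H ->
    (forall v, lab v != star) ->
  exists2 s, extends s & irreducible_graph (derived s).
Proof.
move=> lt_rad starP; pose x0 := (J0, star).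
pose good s := extends s && [forall J, (J, star) \in reach s x0].
have [s0 s0_ext s0_star] := exists_extends_fixing starP.
have good0 : good s0.
  rewrite /good s0_ext; apply/forallP => J; rewrite inE.
  have /connectP[p + ->] := H_irr J0 J; rewrite /x0.
  elim: p (J0) => [|K p IHp] I /=; first by rewrite connect0.
  case/andP=> /existsP[e /andP[/eqP eI /eqP eK]] /IHp.
  apply: connect_trans; apply: connect1.
  by apply/existsP; exists (e, star); rewrite /= eI eK s0_star !eqxx.
case: (arg_maxnP (fun s => #|reach s x0|) good0).
move=> s /andP[s_ext /forallP s_star] s_max.
exists s => //; apply: (@derived_irreducible _ _ H_irr s x0).
apply/eqP; rewrite -subTset; apply/subsetP => x _; apply: contraT => xC.
have fwdC : forward s (~: reach s x0).
  by move=> e t; rewrite ![_ \in ~: _]in_setC reach_edge.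
have C_neq0 : ~: reach s x0 != set0 by apply/set0Pn; exists x; rewrite in_setC.
have [e [u [euC eu]]] := exists_missing_edge lt_rad s_ext fwdC C_neq0.
rewrite in_setC in euC; have eC := s_star (src e).
have C_proper := reach_swap H_irr eC euC.
have good_swap : good (swap s e star u).
  apply/andP; split; last first.
    by apply/forallP => J; apply: (subsetP (proper_sub C_proper)).
  apply/forallP => g; rewrite ffunE.
  have [ge|_] := eqVneq (emap Phi g) e; last exact: (forallP s_ext).
  rewrite permM tpermD -?ge; first exact: (forallP s_ext).
    by rewrite eq_sym starP.
  by rewrite eq_sym eu.
by have /= := s_max _ good_swap; rewrite leqNgt proper_card.
Qed.

End Embedding.

(** * Numbering the fibers *)

Section Labels.
Variables (G H : digraph) (Phi : graph_hom G H) (n : nat).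
Hypothesis le_deg_n : (degree Phi <= n)%N.

Let fiber J := [set v | vmap Phi v == J].

Let index_lt_degree v :
  (index v (enum (fiber (vmap Phi v))) < degree Phi)%N.
Proof.
rewrite /degree (bigD1 (vmap Phi v)) //=.
by apply: leq_trans (leq_maxl _ _); rewrite cardE index_mem mem_enum inE.
Qed.

Definition fiber_label v : 'I_n :=
  Ordinal (leq_trans (index_lt_degree v) le_deg_n).

Lemma fiber_label_inj v w :
  vmap Phi v = vmap Phi w -> fiber_label v = fiber_label w -> v = w.
Proof.
move=> vw /(congr1 val) /=; rewrite vw.
by apply: (index_inj v); rewrite mem_enum inE ?vw.
Qed.

(** Labels are independent of n, so a larger n leaves unused sheets. *)
Lemma fiber_label_lt_degree v : (fiber_label v < degree Phi)%N.
Proof. exact: index_lt_degree. Qed.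

End Labels.

Theorem theorem3p3 (G H : digraph) (Phi : graph_hom G H)
    (Phi_bi_resolving : bi_resolving Phi) (H_irr : irreducible_graph H) :
  (weakly_connected G ->
     exists (G' : digraph) (Phi' : graph_hom G' H),
       [/\ is_extension Phi Phi', bi_covering Phi',
           irreducible_graph G' & degree Phi' = degree Phi]) /\
  (graph_spectral_radius G < graph_spectral_radius H ->
     forall n : nat, (degree Phi < n)%N ->
     exists (G' : digraph) (Phi' : graph_hom G' H),
       [/\ is_extension Phi Phi', bi_covering Phi',
           irreducible_graph G' & degree Phi' = n]).
Proof.
split=> [G_conn | lt_rad n lt_deg_n].
  have lab_inj := @fiber_label_inj G H Phi _ (leqnn _).
  have [s s_ext] := exists_extends Phi_bi_resolving lab_inj.
  exists (derived s), (derived_proj s); split.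
  - exact: extends_is_extension s_ext.
  - exact: derived_bi_covering.
  - have [J0 _|H0] := pickP (mem (vertex H)); last first.
      by move=> x; have := H0 x.1.
    have H_gt0 : (0 < #|vertex H|)%N by apply/card_gt0P; exists J0.
    have [J degE] := @bigop.eq_bigmax _ (fun J => #|[set v | vmap Phi v == J]|) H_gt0.
    apply: (irreducible_of_full_fiber H_irr (J := J) G_conn s_ext).
    apply/eqP; rewrite eqEcard subsetT cardsT card_ord card_in_imset.
      by rewrite /degree degE leqnn.
    move=> v w; rewrite !inE => /eqP vJ /eqP wJ; apply: lab_inj.
    by rewrite vJ wJ.
  - have [J0 _|H0] := pickP (mem (vertex H)).
      by rewrite (degree_derived s J0) card_ord.
    by rewrite /degree !big_pred0.
case: n lt_deg_n => // n lt_deg_n.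
(* Labels are less than deg Phi, so the last sheet can serve as star. *)
have lab_inj := @fiber_label_inj G H Phi _ (ltnW lt_deg_n).
have lab_star v : fiber_label (ltnW lt_deg_n) v != ord_max.
  by rewrite neq_ltn (leq_trans (fiber_label_lt_degree _ v)).
have [J0 _|H0] := pickP (mem (vertex H)); last first.
  (* Without vertices H has no eigenvalue, so its spectral radius is 0. *)
  have /negP[] : ~~ (graph_spectral_radius H <= graph_spectral_radius G).
    by apply/negP => le; have := le_lt_trans le lt_rad; rewrite ltxx.
  apply: spectral_radius_le => z _ /eigenvalueP[w _ /negP[]].
  by apply/eqP/rowP => i; have := H0 (enum_val i).
have [s s_ext s_irr] := exists_irreducible_extends
  Phi_bi_resolving lab_inj H_irr J0 lt_rad lab_star.
exists (derived s), (derived_proj s); split=> //.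
- exact: extends_is_extension s_ext.
- exact: derived_bi_covering.
- by rewrite (degree_derived s J0) card_ord.
Qed.
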